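(* Let $G=(V,E,w)$ be a connected graph with $n=|V|$ nodes and diameter $D$. Assume that the shortest path distance matrix $\mathcal{D}$ of $G$ admits a solution $\kappa^{\mathsf{s}}\in\mathbb{R}^n$ to the equation $\mathcal{D}\kappa^{\mathsf{s}}=n\mathbf{1}$. Then $$\|\kappa^{\mathsf{s}}\|_1\ge\frac{n}{D}.$$
   Context: Graphs $G=(V,E,w)$ have finite node set $V=\{1,\dots,n\}$, undirected edges $E$ without loops or multiple edges, and strictly positive edge weights $w$. The shortest path distance $\Delta(i,j)$ is the unweighted length (number of edges) of a shortest path between $i$ and $j$ (edge weights are ignored); $\mathcal{D}\in\mathbb{R}^{n\times n}$ has entries $\mathcal{D}_{ij}=\Delta(i,j)$. The diameter is $D=\max_{i,j\in V}\Delta(i,j)$. $\mathbf{1}\in\mathbb{R}^n$ is the all-ones vector and $\|\cdot\|_1$ is the $\ell_1$ norm. *)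

(* Defs.v *)
From HB Require Import structures.
From mathcomp Require Import all_boot all_order all_algebra.
From mathcomp Require Import reals.

Set Implicit Arguments.
Unset Strict Implicit.
Unset Printing Implicit Defensive.

Import Order.TTheory GRing.Theory Num.Theory.
Local Open Scope ring_scope.

(* The node set {1, ..., n} is 'I_n, numbered from 0.  The weight is a total
   function, but only its values on edges are constrained or meaningful. *)
Record wgraph (R : realType) (n : nat) := WGraph {
  edge : rel 'I_n;
  weight : 'I_n -> 'I_n -> R;
  edge_sym : symmetric edge;
  edge_irr : irreflexive edge;
  weight_sym : forall i j, edge i j -> weight i j = weight j i;
  weight_gt0 : forall i j, edge i j -> 0 < weight i j
}.

Section Graph.
Variables (R : realType) (n : nat) (G : wgraph R n).

Definition connected_graph : Prop := forall i j, connect (edge G) i j.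

(* The sequence p omits the starting node i, so size p is the number of edges. *)
Definition is_path (i j : 'I_n) (p : seq 'I_n) : bool :=
  [&& path (edge G) i p, last i p == j & uniq (i :: p)].

Definition has_path_of_length (k : nat) (i j : 'I_n) : bool :=
  [exists p : k.-tuple 'I_n, is_path i j p].

(* A path visits distinct nodes, so it has fewer than n edges.  The default
   value n is returned only when no path joins i to j. *)
Definition dist (i j : 'I_n) : nat :=
  \big[minn/n]_(k < n | has_path_of_length k i j) k.

Definition diameter : nat := (\max_(i < n) \max_(j < n) dist i j)%N.

Definition dist_mx : 'M[R]_n := \matrix_(i, j) (dist i j)%:R.

Lemma size_path i j p : is_path i j p -> (size p < n)%N.
Proof.
case/and3P=> _ _ /card_uniqP /= <-.
by rewrite -[X in (_ <= X)%N]card_ord max_card.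
Qed.

Lemma dist_le_size i j p : is_path i j p -> (dist i j <= size p)%N.
Proof.
move=> ijp; have szp := size_path ijp.
have hp : has_path_of_length (Ordinal szp) i j.
  by apply/existsP; exists (in_tuple p).
rewrite /dist -[size p]/(nat_of_ord (Ordinal szp)).
elim: (index_enum _) (mem_index_enum (Ordinal szp)) => // k s IHs.
rewrite inE big_cons; case: eqP => [<- _ | _ /= /IHs le_s]; first by rewrite hp geq_minl.
by case: ifP => // _; rewrite geq_min le_s orbT.
Qed.

Lemma dist_attained i j : connected_graph ->
  exists2 p, is_path i j p & size p = dist i j.
Proof.
move=> conG.
have [q ijq] : exists q, is_path i j q.
  have /connectP[q0 pq0 ->] := conG i j.
  case: (shortenP pq0) => q pq uq _.
  by exists q; rewrite /is_path pq uq eqxx.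
have lt_n : (dist i j < n)%N.
  exact: leq_ltn_trans (dist_le_size ijq) (size_path ijq).
have : (dist i j = n) \/ has_path_of_length (dist i j) i j.
  rewrite /dist; elim/big_ind: _ => [|x y Hx Hy|k hk]; [by left | | by right].
  by case: (leqP x y).
case=> [eqn | /existsP[p ijp]]; first by rewrite eqn ltnn in lt_n.
by exists p; rewrite // size_tuple.
Qed.

End Graph.

Definition l1norm (R : realType) (n : nat) (x : 'cV[R]_n) : R :=
  \sum_(i < n) `|x i 0|.

(* Main.v *)
Require Import Defs.
From mathcomp Require Import all_boot all_order all_algebra.
From mathcomp Require Import reals.
Import Order.TTheory GRing.Theory Num.Theory.
Local Open Scope ring_scope.

(** Any single row [i] of the equation reads [n = \sum_j dist i j * kappa j].
    Distances lie between 0 and the diameter, so the triangle inequality bounds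
    the right-hand side by the diameter times the l1 norm of [kappa]
    ([dist_mx_mul_le]); dividing by the diameter gives the result.  When there
    is no row, or when the diameter is 0 (division by 0 yields 0), the quotient
    is 0 and the bound is the nonnegativity of the norm. *)

Lemma l1norm_ge0 (R : realType) (n : nat) (x : 'cV[R]_n) : 0 <= l1norm x.
Proof. exact: sumr_ge0. Qed.

Lemma dist_le_diameter (R : realType) (n : nat) (G : wgraph R n) (i j : 'I_n) :
  (dist G i j <= diameter G)%N.
Proof.
apply: leq_trans (leq_bigmax (F := fun i => \max_(j < n) dist G i j)%N i).
exact: (leq_bigmax (F := dist G i)).
Qed.

(** The Hoelder inequality between the l1 norm of [x] and the sup norm of row
    [i], whose entries the diameter bounds. *)
Lemma dist_mx_mul_le (R : realType) (n : nat) (G : wgraph R n) (x : 'cV[R]_n)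
    (i : 'I_n) :
  `|(dist_mx G *m x) i 0| <= (diameter G)%:R * l1norm x.
Proof.
rewrite mxE /l1norm mulr_sumr; apply: le_trans (ler_norm_sum _ _ _) _.
apply: ler_sum => j _.
by rewrite mxE normrM normr_nat ler_wpM2r // ler_nat dist_le_diameter.
Qed.

Theorem theorem1p4 (R : realType) (n : nat) (G : wgraph R n) (kappa : 'cV[R]_n)
    (hconn : connected_graph G)
    (hkappa : dist_mx G *m kappa = n%:R *: const_mx 1) :
  n%:R / (diameter G)%:R <= l1norm kappa.
Proof.
have [D0 | D_gt0] := posnP (diameter G).
  by rewrite D0 invr0 mulr0 l1norm_ge0.
case: n => [|n] in G kappa hconn hkappa D_gt0 *.
  by rewrite mul0r l1norm_ge0.
rewrite ler_pdivrMr ?ltr0n // mulrC.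
by have := dist_mx_mul_le _ _ G kappa ord0; rewrite hkappa !mxE mulr1 normr_nat.
Qed.
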